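(* Let $\Lambda = (\lambda_k)_{k=0}^\infty$ be a strictly increasing sequence of non-negative real numbers with $\sum_{k=1}^\infty 1/\lambda_k < \infty$, and let $M(\Lambda) = \overline{\operatorname{span}}\{t^{\lambda_k}\}_{k=0}^\infty \subset C[0,1]$ be the associated Müntz space. Then $M(\Lambda)$ contains an asymptotically isometric copy of $c_0$.
   Context: $C[0,1]$ is the Banach space of real-valued continuous functions on $[0,1]$ with the max-norm. For a strictly increasing sequence $\Lambda = (\lambda_k)_{k=0}^\infty$ of non-negative real numbers, $M(\Lambda)$ denotes the closed linear span in $C[0,1]$ of the functions $t \mapsto t^{\lambda_k}$, $k \ge 0$ (with $t^0 = 1$), with the inherited norm. $M(\Lambda)$ is called a Müntz space if $\sum_{k=1}^\infty 1/\lambda_k < \infty$. A Banach space $X$ is said to contain an asymptotically isometric copy of $c_0$ if there exist a sequence $(x_n)_{n=1}^\infty$ in $X$ and constants $0 < m < M < \infty$ such that for all scalar sequences $(t_n)_{n=1}^\infty$ with finitely many non-zero terms $$m \sup_n |t_n| \le \Big\| \sum_n t_n x_n \Big\| \le M \sup_n |t_n|,$$ and $\lim_{n\to\infty} \|x_n\| = M$. *)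

(* Defs.v *)
From HB Require Import structures.
From mathcomp Require Import all_boot all_order all_algebra.
From mathcomp Require Import ring.
From mathcomp Require Import all_classical all_reals all_analysis.
Set Implicit Arguments.
Unset Strict Implicit.
Unset Printing Implicit Defensive.
Import Order.TTheory GRing.Theory Num.Theory.
Import numFieldNormedType.Exports.
Local Open Scope classical_set_scope.
Local Open Scope ring_scope.

(* [0,1] as a type, with the subtype topology. *)
Notation unitI R := (set_type (`[0%R, 1%R]%classic : set (Real.sort R))).

Section C01_def.
Variable R : realType.

Definition continuousb : {pred unitI R -> R} := mem [set f | continuous f].

Lemma continuousb_submod : submod_closed continuousb.
Proof.
split; first by apply/mem_set; exact: (@cst_continuous _ R 0).
move=> a f g /set_mem cf /set_mem cg; apply/mem_set => t.
have : a * f x + g x @[x --> t] --> a * f t + g t.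
  apply: (@cvgD _ _ _ _ (nbhs_filter t)); last exact: cg.
  by apply: (@cvgMl_tmp _ _ _ (nbhs_filter t)); exact: cf.
exact.
Qed.

HB.instance Definition _ :=
  GRing.isSubmodClosed.Build R (unitI R -> R) continuousb continuousb_submod.

(* C[0,1], normed below by [C01_norm]. *)
Record C01 := MkC01 { C01_fun :> unitI R -> R ; C01P : C01_fun \in continuousb }.

HB.instance Definition _ := [isSub for C01_fun].
HB.instance Definition _ := [Choice of C01 by <:].
HB.instance Definition _ := [SubChoice_isSubLmodule of C01 by <:].

End C01_def.

Section C01_norm.
Variable R : realType.
Implicit Types f g : C01 R.

Lemma C01_cont f : continuous f.
Proof. by move: (C01P f); rewrite inE. Qed.

Definition C01_norm f : R := sup [set `|f t| | t in [set: unitI R]].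

Lemma C01_norm_max f :
  exists t : unitI R, (forall s, `|f s| <= `|f t|) /\ C01_norm f = `|f t|.
Proof.
pose g (t : unitI R) : R := `|f t|.
have cg : continuous g.
  move=> t; apply: (@continuous_comp _ _ _ f (fun x : R => `|x|)).
    exact: C01_cont.
  exact: norm_continuous.
have cg' : {within `[0, 1], continuous (valL_ (0 : R) g)}.
  exact/subspace_valL_continuousP'.
have [c c01 Hc] := EVT_max ler01 cg'.
have cI : c \in (`[0, 1]%classic : set R) by rewrite inE.
pose t : unitI R := exist _ c cI.
have Ht s : `|f s| <= `|f t|.
  have := Hc (\val s); rewrite -[c]/(\val t).
  have E u : valL_ 0 g (\val u) = `|f u| by rewrite -[RHS]/(g u) -[in RHS](valLK 0 g).
  rewrite !E; apply.
  by have := set_valP s.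
exists t; split=> //.
apply/le_anti/andP; split.
  apply: ge_sup; first by exists `|f t|; exists t.
  by move=> _ [s _ <-].
apply: ub_le_sup; last by exists t.
by exists `|f t| => _ [s _ <-].
Qed.

Lemma C01_norm_ub f t : `|f t| <= C01_norm f.
Proof. by have [s [H ->]] := C01_norm_max f. Qed.

Lemma C01_norm_le f (e : R) : (forall t, `|f t| <= e) -> C01_norm f <= e.
Proof. by move=> H; have [s [_ ->]] := C01_norm_max f. Qed.

Lemma C01_ler_normD f g : C01_norm (f + g) <= C01_norm f + C01_norm g.
Proof.
apply: C01_norm_le => t; rewrite (le_trans (ler_normD _ _))//.
by rewrite lerD ?C01_norm_ub.
Qed.

Lemma C01_normrZ (a : R) f : C01_norm (a *: f) = `|a| * C01_norm f.
Proof.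
have [t [H1 ->]] := C01_norm_max f.
have [s [H2 ->]] := C01_norm_max (a *: f).
apply/le_anti/andP; split.
  by rewrite -[(a *: f) s]/(a * f s) normrM ler_wpM2l.
by rewrite -normrM; exact: H2.
Qed.

Lemma C01_normr0_eq0 f : C01_norm f = 0 -> f = 0.
Proof.
move=> f0; apply: val_inj; apply/funext => t /=.
apply/eqP; rewrite -normr_le0; have := C01_norm_ub f t; by rewrite f0.
Qed.

HB.instance Definition _ := Lmodule_isNormed.Build R (C01 R)
  C01_ler_normD C01_normrZ C01_normr0_eq0.

Lemma C01_normE f : `|f| = sup [set `|f t| | t in [set: unitI R]].
Proof. by []. Qed.

Lemma C01_complete (F : set_system (C01 R)) :
  ProperFilter F -> cauchy F -> cvg F.
Proof.
move=> FF /cauchy_ballP Fc.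
have Fc2 (e : R) : 0 < e -> \forall f \near F & g \near F, `|f - g| < e.
  by move=> e0; have := Fc _ e0; rewrite /= -ball_normE.
have Et (t : unitI R) : cvg ((f : C01 R) t @[f --> F]).
  apply: cauchy_cvg; apply: cauchy_exP => e e0.
  have [f Hf] := filter_ex (nearP_dep (Fc2 _ e0)).
  exists (f t); apply: filterS Hf => g fg; rewrite -ball_normE /=.
  by apply: le_lt_trans fg; exact: (C01_norm_ub (f - g)).
pose h t : R := lim ((f : C01 R) t @[f --> F]).
have Fh (e : R) : 0 < e -> \forall f \near F, forall t, `|(f : C01 R) t - h t| <= e.
  move=> e0; have /nearP_dep Fc1 := Fc2 _ e0.
  apply: filterS Fc1 => f Hf t.
  have cf : `|f t - (g : C01 R) t| @[g --> F] --> `|f t - h t|.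
    by apply: cvg_norm; apply: cvgB; [exact: cvg_cst|exact: Et].
  rewrite -(cvg_lim _ cf)//; apply: limr_le; first by apply/cvg_ex; eexists; exact: cf.
  apply: filterS Hf => g /ltW fg.
  exact: le_trans (C01_norm_ub (f - g) t) fg.
have ch : continuous h.
  move=> t; apply/(@cvgrPdist_le _ _ _ _ (nbhs_filter t)) => e e0.
  have e3 : 0 < e / 3 by rewrite divr_gt0.
  have [f Hf] := filter_ex (Fh _ e3).
  have /(@cvgrPdist_le _ _ _ _ (nbhs_filter t)) /(_ _ e3) := @C01_cont f t.
  apply: filterS => s fts.
  rewrite (_ : h t - h s = (h t - f t) + (f t - f s) + (f s - h s)); last by ring.
  rewrite (_ : e = e / 3 + e / 3 + e / 3); last by field.
  rewrite (le_trans (ler_normD _ _))// lerD// (le_trans (ler_normD _ _))// lerD//.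
  by rewrite distrC.
have hP : h \in @continuousb R by rewrite inE.
apply/cvg_ex; exists (MkC01 hP); apply/cvgrPdist_le => e e0.
apply: filterS (Fh _ e0) => f Hf.
by apply: C01_norm_le => t; rewrite distrC; exact: Hf.
Qed.

HB.instance Definition _ := Uniform_isComplete.Build (C01 R) C01_complete.

End C01_norm.

Section closed_span.
Variables (R : realType) (V : completeNormedModType R) (S : set V).

Definition lin_span : set V := [set v | exists (n : nat) (c : 'I_n -> R)
  (s : 'I_n -> V), (forall i, S (s i)) /\ v = \sum_(i < n) c i *: s i].

Lemma lin_span0 : lin_span 0.
Proof. by exists 0%N, (fun=> 0), (fun=> 0); split=> [[]//|]; rewrite big_ord0. Qed.

Lemma lin_span_gen v : S v -> lin_span v.
Proof.
by move=> Sv; exists 1%N, (fun=> 1), (fun=> v); split=> //; rewrite big_ord1 scale1r.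
Qed.

Lemma lin_spanP a u v : lin_span u -> lin_span v -> lin_span (a *: u + v).
Proof.
move=> [n [c [s [Hs ->]]]] [m [d [t [Ht ->]]]].
exists (n + m)%N,
  (fun i => match fintype.split i with inl j => a * c j | inr j => d j end),
  (fun i => match fintype.split i with inl j => s j | inr j => t j end); split.
  by move=> i; case: fintype.split.
rewrite big_split_ord /= scaler_sumr; congr (_ + _); apply: eq_bigr => i _.
  by rewrite -[lshift _ _]/(unsplit (inl i)) unsplitK scalerA.
by rewrite -[rshift _ _]/(unsplit (inr i)) unsplitK.
Qed.

Definition closed_spanb : {pred V} := mem (closure lin_span).

Lemma closed_spanP v : reflect
  (forall e : R, 0 < e -> exists2 u, lin_span u & `|v - u| < e)
  (v \in closed_spanb).
Proof.
apply: (iffP idP) => [/set_mem cv e e0|H].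
  have [u [Lu]] := cv _ (nbhsx_ballx v e e0).
  by rewrite -ball_normE; exists u.
apply/mem_set => B /nbhs_ballP[e /= e0 He].
by have [u Lu uv] := H _ e0; exists u; split=> //; apply: He; rewrite -ball_normE.
Qed.

Lemma closed_span_submod : submod_closed closed_spanb.
Proof.
split; first by apply/mem_set/subset_closure/lin_span0.
move=> a u v /closed_spanP Hu /closed_spanP Hv; apply/closed_spanP => e e0.
have k0 : 0 < `|a| + 1 by rewrite ltr_wpDl.
have [u' Lu' uu'] := Hu (e / 2 / (`|a| + 1)) ltac:(by rewrite !divr_gt0).
have [v' Lv' vv'] := Hv (e / 2) ltac:(by rewrite divr_gt0).
exists (a *: u' + v'); first exact: lin_spanP.
rewrite opprD addrACA -scalerBr (le_lt_trans (ler_normD _ _))// [e]splitr.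
rewrite ler_ltD// normrZ (le_trans (ler_wpM2l (normr_ge0 a) (ltW uu')))//.
rewrite mulrCA ler_piMr ?divr_ge0 ?ltW// ltr_pdivrMr// mul1r ltrDl//.
Qed.

HB.instance Definition _ :=
  GRing.isSubmodClosed.Build R V closed_spanb closed_span_submod.

(* The closure of [lin_span S] as a Banach space, with the norm of V. *)
Record closed_span := ClosedSpan
  { closed_span_val :> V ; closed_span_valP : closed_span_val \in closed_spanb }.

HB.instance Definition _ := [isSub for closed_span_val].
HB.instance Definition _ := [Choice of closed_span by <:].
HB.instance Definition _ := [SubChoice_isSubLmodule of closed_span by <:].

Definition closed_span_norm (x : closed_span) : R := `|closed_span_val x|.

Lemma closed_span_normD x y :
  closed_span_norm (x + y) <= closed_span_norm x + closed_span_norm y.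
Proof. exact: ler_normD. Qed.

Lemma closed_span_normZ (a : R) x :
  closed_span_norm (a *: x) = `|a| * closed_span_norm x.
Proof. exact: normrZ. Qed.

Lemma closed_span_norm0 x : closed_span_norm x = 0 -> x = 0.
Proof. by move=> /normr0_eq0 x0; exact: val_inj. Qed.

HB.instance Definition _ := Lmodule_isNormed.Build R closed_span
  closed_span_normD closed_span_normZ closed_span_norm0.

Lemma closed_span_normE (x : closed_span) : `|x| = `|closed_span_val x|.
Proof. by []. Qed.

Lemma closed_span_complete (F : set_system closed_span) :
  ProperFilter F -> cauchy F -> cvg F.
Proof.
move=> FF /cauchy_ballP Fc.
have Fc2 (e : R) : 0 < e -> \forall f \near F & g \near F, `|f - g| < e.
  by move=> e0; have := Fc _ e0; rewrite /= -ball_normE.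
have Fl : cvg (closed_span_val x @[x --> F]).
  apply: cauchy_cvg; apply: cauchy_exP => e e0.
  have [f Hf] := filter_ex (nearP_dep (Fc2 _ e0)).
  by exists (closed_span_val f); apply: filterS Hf => g fg; rewrite -ball_normE.
set l := lim _ in Fl.
have Hl (e : R) : 0 < e -> \forall x \near F, `|l - closed_span_val x| <= e.
  by move=> e0; move/cvgrPdist_le : Fl; exact.
have lS : l \in closed_spanb.
  apply/closed_spanP => e e0.
  have e2 : 0 < e / 2 by rewrite divr_gt0.
  have [x Hx] := filter_ex (Hl _ e2).
  have [u Lu xu] := (closed_spanP _ (closed_span_valP x)) _ e2.
  exists u => //; rewrite -(subrK (closed_span_val x) l) -addrA [e]splitr.
  by rewrite (le_lt_trans (ler_normD _ _))// ler_ltD.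
apply/cvg_ex; exists (ClosedSpan lS); apply/cvgrPdist_le => e e0.
exact: Hl.
Qed.

HB.instance Definition _ :=
  Uniform_isComplete.Build closed_span closed_span_complete.

End closed_span.

Section muntz.
Variable R : realType.
Implicit Types (lambda : nat -> R).

Lemma powR_cont01 (a : R) : 0 <= a ->
  (fun t : unitI R => \val t `^ a) \in @continuousb R.
Proof.
rewrite le_eqVlt => /predU1P[<-|a0]; apply/mem_set.
  rewrite (_ : (fun _ => _) = cst 1); first exact: cst_continuous.
  by apply/funext => t; rewrite powRr0.
suff : {within `[0, 1], continuous (fun x : R => x `^ a)}.
  by move/subspace_sigL_continuousP.
have cpos (x : R) : 0 < x -> {for x, continuous (fun x : R => x `^ a)}.
  move=> x0; apply/differentiable_continuous/derivable1_diffP.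
  by apply: derivable_powR; rewrite in_itv /= x0.
apply/(continuous_within_itvP _ ltr01); split.
- by move=> x; rewrite in_itv /= => /andP[x0 _]; exact: cpos.
- by rewrite powR0 ?gt_eqF//; exact: powR_cvg0.
- exact/cvg_at_left_filter/cpos.
Qed.

(* The functions t |-> t `^ lambda k; when lambda k >= 0 they do exist in C[0,1]
   (see [muntz_monomials_nth]). Note that 0 `^ 0 = 1. *)
Definition muntz_monomials lambda : set (C01 R) :=
  [set f | exists k, forall t : unitI R, f t = \val t `^ lambda k].

Lemma muntz_monomials_nth lambda k : 0 <= lambda k ->
  exists2 f : C01 R, muntz_monomials lambda f &
    forall t : unitI R, f t = \val t `^ lambda k.
Proof. by move=> k0; exists (MkC01 (powR_cont01 k0)) => //; exists k. Qed.

Definition muntz_space lambda : completeNormedModType R :=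
  closed_span (muntz_monomials lambda).

End muntz.

(* X contains an asymptotically isometric copy of c_0. The scalar sequences t
   with finitely many non-zero terms are those supported in [0, N) for some N. *)
Definition contains_ai_c0 (R : realType) (X : completeNormedModType R) : Prop :=
  exists (x : nat -> X) (m M : R),
    [/\ 0 < m, m < M,
        forall (t : nat -> R) (N : nat), (forall n, (N <= n)%N -> t n = 0) ->
          m * sup [set `|t n| | n in [set: nat]] <= `|\sum_(n < N) t n *: x n|
          /\ `|\sum_(n < N) t n *: x n| <= M * sup [set `|t n| | n in [set: nat]]
      & `|x n| @[n --> \oo] --> M].

(* Main.v *)
Require Import Defs.
From HB Require Import structures.
From mathcomp Require Import all_boot all_order all_algebra.
From mathcomp Require Import ring lra.
From mathcomp Require Import all_classical all_reals all_analysis.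
Set Implicit Arguments.
Unset Strict Implicit.
Unset Printing Implicit Defensive.
Import Order.TTheory GRing.Theory Num.Theory.
Import numFieldNormedType.Exports.
Local Open Scope classical_set_scope.
Local Open Scope ring_scope.

(** Choose exponents [a 0, a 1, ...] among the [lambda k] growing so fast that
the bumps [f n = t^(a n) - t^(a n.+1)] have norm tending to 1. They are
nonnegative and telescope to a sum at most 1, which gives the upper c_0-estimate
with constant 1. At a point where [f n] is at least 3/4 all the other bumps
together contribute at most 1/4, which gives the lower one with constant 1/2. *)

Lemma closed_span_C01_sumE (R : realType) (S : set (C01 R)) (I : Type)
    (r : seq I) (c : I -> R) (x : I -> closed_span S) (s : unitI R) :
  closed_span_val (\sum_(i <- r) c i *: x i) s =
  \sum_(i <- r) c i * closed_span_val (x i) s.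
Proof.
have valZ (a : R) (z : closed_span S) :
  closed_span_val (a *: z) = a *: closed_span_val z by [].
have evalZ (a : R) (f : C01 R) : (a *: f) s = a * f s by [].
have evalD (y z : closed_span S) :
  closed_span_val (y + z) s = closed_span_val y s + closed_span_val z s by [].
elim: r => [|i r IH]; first by rewrite !big_nil.
by rewrite !big_cons evalD valZ evalZ IH.
Qed.

(** This separates the c_0 estimates from the choice of exponents: they hold for any nonnegative
    functions with partial sums at most 1, [p n] being a point where [x n] is large. *)
Lemma contains_ai_c0_bumps (R : realType) (S : set (C01 R))
    (x : nat -> closed_span S) (p : nat -> unitI R) :
  (forall n s, 0 <= closed_span_val (x n) s) ->
  (forall N s, \sum_(n < N) closed_span_val (x n) s <= 1) ->
  (forall n, 3 / 4 <= closed_span_val (x n) (p n)) ->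
  `|x n| @[n --> \oo] --> (1 : R) ->
  contains_ai_c0 (closed_span S).
Proof.
move=> x0 x1 xp xcvg; exists x, 2^-1, 1; split => //; try lra.
move=> t N tN; set A := [set _ | _ in _]; set T := sup A.
set y := \sum_(n < N) _.
have Aub : has_ubound A.
  exists (\sum_(n < N) `|t n|) => _ [n _ <-].
  have [Nn|nN] := leqP N n; first by rewrite tN// normr0 sumr_ge0.
  by rewrite (bigD1 (Ordinal nN))//= lerDl sumr_ge0.
have tT n : `|t n| <= T by apply: ub_le_sup => //; exists n.
have T0 : 0 <= T := le_trans (normr_ge0 _) (tT 0%N).
have yE s : closed_span_val y s = \sum_(n < N) t n * closed_span_val (x n) s.
  by rewrite /y closed_span_C01_sumE.
have termT n s : `|t n * closed_span_val (x n) s| <= T * closed_span_val (x n) s.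
  by rewrite normrM (ger0_norm (x0 _ _)) ler_wpM2r.
split; last first.
  rewrite mul1r closed_span_normE; apply: C01_norm_le => s.
  rewrite yE (le_trans (ler_norm_sum _ _ _))//.
  rewrite (le_trans (ler_sum _ (fun (n : 'I_N) _ => termT n s)))//.
  by rewrite -mulr_sumr ler_piMr //; exact: x1.
(* Absorbing the [T] on the right gives [T / 2 <= |y|], so the supremum need not be known to be
   attained. *)
suff TY : T <= 4 / 3 * (`|y| + T / 4) by lra.
apply: ge_sup; first by exists `|t 0%N|, 0%N.
move=> _ [n _ <-]; have [Nn|nN] := leqP N n.
  by rewrite tN// normr0 mulr_ge0 ?addr_ge0 ?divr_ge0.
pose n' := Ordinal nN; pose s := p n.
have ys : `|closed_span_val y s| <= `|y|.
  by rewrite closed_span_normE; exact: C01_norm_ub.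
(* At [p n] the bump [x n] takes at least 3/4 of a total of at most 1. *)
have others : `|\sum_(k < N | k != n') t k * closed_span_val (x k) s| <= T / 4.
  rewrite (le_trans (ler_norm_sum _ _ _))//.
  rewrite (le_trans (ler_sum _ (fun (k : 'I_N) _ => termT k s)))//.
  rewrite -mulr_sumr ler_wpM2l//.
  have := x1 N s; rewrite (bigD1 n')//=; have := xp n; rewrite -/s; lra.
have tns : `|t n| * (3 / 4) <= `|t n * closed_span_val (x n) s|.
  by rewrite normrM (ger0_norm (x0 _ _)) ler_wpM2l// xp.
have := lerB_normD (t n * closed_span_val (x n) s)
  (\sum_(k < N | k != n') t k * closed_span_val (x k) s).
have -> : t n * closed_span_val (x n) s +
    \sum_(k < N | k != n') t k * closed_span_val (x k) s = closed_span_val y s.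
  by rewrite yE [RHS](bigD1 n').
lra.
Qed.

(** Take [s = exp (- d)] with [d = e / (2 * a)]. Then [s^a = exp (- e / 2) >= 1 - e / 2], while
    [d * b >= 2 / e] and [exp u >= u] give [s^b <= e / 2]. *)
Lemma powR_bump_peak (R : realType) (a b e : R) :
  0 < a -> 0 < e -> 4 * a / e ^+ 2 <= b ->
  exists s : unitI R, 1 - e <= \val s `^ a - \val s `^ b.
Proof.
move=> a0 e0 ab; pose d := e / 2 / a.
have d0 : 0 < d by rewrite !divr_gt0.
have sI : expR (- d) \in (`[0, 1]%classic : set R).
  by rewrite inE /= in_itv /= expR_ge0 -expR0 ler_expR oppr_le0 ltW.
exists (exist _ (expR (- d)) sI) => /=.
rewrite -!expRM.
have -> : - d * a = - (e / 2) by rewrite /d mulNr divfK ?gt_eqF.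
have := expR_ge1Dx (- (e / 2)).
have db : 2 / e <= d * b.
  apply: le_trans (ler_wpM2l (ltW d0) ab).
  rewrite /d le_eqVlt; apply/orP; left; apply/eqP.
  by field; rewrite !gt_eqF.
have : expR (- d * b) <= e / 2.
  rewrite mulNr expRN -[e / 2]invrK invf_div lef_pV2 ?posrE ?expR_gt0 ?divr_gt0//.
  by rewrite (le_trans db)// (le_trans _ (expR_ge1Dx _))// lerDr.
lra.
Qed.

(** Positivity lets a small inverse force a large value; it also excludes 0, whose inverse is 0 by
    convention. *)
Lemma cvgV0_unbounded (R : realType) (u : nat -> R) :
  (forall n, 0 < u n) -> (u n)^-1 @[n --> \oo] --> (0 : R) ->
  forall B, exists n, B <= u n.
Proof.
move=> u0 uV B.
have B0 : 0 < `|B| + 1 by rewrite ltr_wpDl.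
have /cvgrPdist_lt/(_ (`|B| + 1)^-1) := uV.
rewrite invr_gt0 => /(_ B0) [n _ /(_ n (leqnn n))] /=.
rewrite sub0r normrN gtr0_norm ?invr_gt0// ltf_pV2 ?posrE// => Bu.
by exists n; have := ler_norm B; lra.
Qed.

Theorem theorem2p6 (R : realType) (lambda : nat -> R)
    (lambda_ge0 : forall k, 0 <= lambda k)
    (lambda_incr : forall i j, (i < j)%N -> lambda i < lambda j)
    (lambda_summable : cvgn (series (fun k => (lambda k.+1)^-1))) :
  contains_ai_c0 (muntz_space lambda).
Proof.
(* The terms of a convergent series tend to 0. From index 1 on the exponents exceed [lambda 0 >= 0],
   hence are positive. *)
have unbounded B : exists k, B <= lambda k.
  have [k|k Bk] := @cvgV0_unbounded R (fun k => lambda k.+1) _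
    (cvg_series_cvg_0 lambda_summable) B; last by exists k.+1.
  exact: le_lt_trans (lambda_ge0 0%N) (lambda_incr _ _ _).
have [g gP] := choice unbounded.
(* At most 1/4, which makes the peaks at least 3/4, and tending to 0, which makes the norms tend to
   1. *)
pose e n : R := n.+4%:R^-1.
have e0 n : 0 < e n by rewrite invr_gt0.
(* The growth is what [powR_bump_peak] asks for; starting from [g 1] makes every chosen exponent
   positive. *)
pose fix k n := if n is m.+1 then g (4 * lambda (k m) / e m ^+ 2) else g 1.
pose a n := lambda (k n).
have aS n : 4 * a n / e n ^+ 2 <= a n.+1 by exact: gP.
have a_gt0 n : 0 < a n.
  elim: n => [|n IH]; first exact: lt_le_trans (gP 1).
  by apply: lt_le_trans (aS n); rewrite divr_gt0 ?exprn_gt0 ?mulr_gt0.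
have e4 n : e n <= 1 / 4 by rewrite div1r lef_pV2 ?posrE// ler_nat.
have a_le n : a n <= a n.+1.
  apply: le_trans (aS n); rewrite ler_pdivlMr ?exprn_gt0//.
  have : e n ^+ 2 <= 1 by rewrite exprn_ile1 ?ltW//; have := e4 n; lra.
  by move=> en; rewrite [leLHS]mulrC ler_wpM2r ?ltW// (le_lt_trans en)// ltr1n.
pose P n : C01 R := MkC01 (powR_cont01 (ltW (a_gt0 n))).
have Pspan n : P n \in closed_spanb (muntz_monomials lambda).
  by apply/mem_set/subset_closure/lin_span_gen; exists (k n).
have bumpP n : P n - P n.+1 \in closed_spanb (muntz_monomials lambda).
  exact: rpredB.
pose x n : muntz_space lambda := ClosedSpan (bumpP n).
have xE n s : closed_span_val (x n) s = \val s `^ a n - \val s `^ a n.+1 by [].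
have val01 (s : unitI R) : 0 <= \val s <= 1.
  by have := set_valP s; rewrite /= in_itv.
have x_ge0 n s : 0 <= closed_span_val (x n) s.
  rewrite xE subr_ge0; have /andP[] := val01 s.
  rewrite le_eqVlt => /predU1P[<- _|s0 s1]; first by rewrite !powR0 ?gt_eqF.
  by rewrite ger_powR// s0.
have x_sum N s : \sum_(n < N) closed_span_val (x n) s <= 1.
  rewrite -(big_mkord xpredT (fun n => closed_span_val (x n) s)).
  (* The sum telescopes to [s^(a 0) - s^(a N)]. *)
  under eq_bigr do rewrite xE -opprB.
  rewrite sumrN telescope_sumr// opprB.
  have : \val s `^ a 0%N <= 1.
    have /andP[s0 s1] := val01 s.
    by rewrite -[leRHS]/((fun=> 1) (a 0%N)) -powR1 ge0_ler_powR ?nnegrE// ltW.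
  have := powR_ge0 (\val s) (a N); lra.
have [p pP] := choice (fun n => powR_bump_peak (a_gt0 n) (e0 n) (aS n)).
apply: (contains_ai_c0_bumps (x := x) (p := p)) => //.
  by move=> n; rewrite xE; have := pP n; have := e4 n; lra.
(* [harmonic n] is [1 / (n + 1)], which dominates [e n] and tends to 0. *)
apply: (@squeeze_cvgr _ _ _ _ (fun n => 1 - harmonic n) (fun=> 1)); last 2 first.
- by rewrite -[X in _ --> X]subr0; apply: cvgB; [exact: cvg_cst|exact: cvg_harmonic].
- exact: cvg_cst.
near=> n; apply/andP; split.
  apply: (@le_trans _ _ (1 - e n)).
    by rewrite lerD2l lerN2 lef_pV2 ?posrE// ler_nat ltnS -addn3 leq_addr.
  apply: le_trans (pP n) _; rewrite -xE closed_span_normE.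
  exact: le_trans (ler_norm _) (C01_norm_ub _ _).
(* A single bump is the last term of a sum of nonnegative bumps that is at most 1. *)
rewrite closed_span_normE; apply: C01_norm_le => s.
rewrite ger0_norm ?x_ge0//; apply: le_trans (x_sum n.+1 s).
by rewrite big_ord_recr /= lerDr; apply: sumr_ge0 => i _; exact: x_ge0.
Unshelve. all: by end_near.
Qed.
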